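(* If the differentiation operator $D$ is bounded on a discrete function space $\mathcal{X}$ on a tree $T$, then \[\sigma(D)=1-\sigma(C_b)=\{1-\lambda:\lambda\in\sigma(C_b)\}.\]
   Context: A tree $T$ is a locally finite, connected, simply-connected graph, identified with its set of vertices. A vertex is terminal if it has a unique neighbor; all trees are assumed to be without terminal vertices (hence infinite) and rooted at a vertex $o$. For $v\neq o$, $v^-$ denotes the unique neighbor of $v$ lying on the path from $o$ to $v$ (the parent of $v$). A function on $T$ is a complex-valued function on its vertices. The backward shift map $b:T\to T$ is $b(v)=v^-$ for $v\neq o$ and $b(o)=o$. The derivative of $f:T\to\mathbb{C}$ is $f'(v)=f(v)-f(b(v))$ for all $v\in T$ (so $f'(o)=0$). A functional Banach space on a set $\Omega$ is a Banach space of complex-valued functions on $\Omega$ with pointwise vector operations, such that $f(x)=g(x)$ for all $x\in\Omega$ implies $f=g$, $f(x)=f(y)$ for every $f$ in the space implies $x=y$, and for each $x\in\Omega$ the linear functional $f\mapsto f(x)$ is continuous. A discrete function space $\mathcal{X}$ on $T$ is a functional Banach space whose elements are functions on $T$, with norm $\|\cdot\|_{\mathcal{X}}$. The differentiation operator is $Df=f'$, and the composition operator induced by $b$ is $C_bf=f\circ b$. An operator is bounded on $\mathcal{X}$ if it is a bounded linear operator from $\mathcal{X}$ to $\mathcal{X}$ ($D$ is bounded on $\mathcal{X}$ if and only if $C_b$ is). $\sigma(A)$ denotes the spectrum of a bounded operator $A$ on $\mathcal{X}$. *)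

(* Defs.v *)
From HB Require Import structures.
From mathcomp Require Import all_boot all_order all_algebra.
From mathcomp Require Import complex.
From mathcomp Require Import all_classical all_reals all_analysis.

Set Implicit Arguments.
Unset Strict Implicit.
Unset Printing Implicit Defensive.

Import Order.TTheory GRing.Theory Num.Theory.
Import numFieldNormedType.Exports.

Local Open Scope classical_set_scope.
Local Open Scope ring_scope.
Local Open Scope complex_scope.

Definition terminal (V : choiceType) (adj : rel V) (v : V) : Prop :=
  exists! u, adj v u.

Definition simple_path (V : choiceType) (adj : rel V) (u v : V) (p : seq V) :=
  [/\ path adj u p, last u p = v & uniq (u :: p)].

(* [tree_acyclic] expresses simple connectedness: a duplicate-free closed walk
   [:: x; y] traverses one edge back and forth, so a cycle of the graph is a
   [ucycle] with at least three vertices.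
   The graph reduced to one vertex has no terminal vertex in the sense of
   [terminal]; [tree_nontrivial] excludes it, so that all trees are infinite. *)
Record rootedTree := RootedTree {
  tree_vertex :> choiceType;
  tree_adj : rel tree_vertex;
  tree_root : tree_vertex;
  tree_adj_sym : symmetric tree_adj;
  tree_adj_irr : irreflexive tree_adj;
  tree_locally_finite : forall v, finite_set [set u | tree_adj v u];
  tree_connected : forall u v, exists2 p, path tree_adj u p & last u p = v;
  tree_acyclic : forall c, ucycle tree_adj c -> (size c < 3)%N;
  tree_no_terminal : forall v, ~ terminal tree_adj v;
  tree_nontrivial : exists u v : tree_vertex, u != v
}.

Section Tree.
Variable T : rootedTree.

Let o : T := tree_root T.

Definition is_parent (v u : T) : Prop :=
  tree_adj v u /\
  exists2 p, simple_path (@tree_adj T) o v p & u \in o :: p.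

Definition parent (v : T) : T := xget o [set u | is_parent v u].

Definition backward_shift (v : T) : T := if v == o then o else parent v.

Definition differentiation (K : zmodType) (f : T -> K) : T -> K :=
  fun v => f v - f (backward_shift v).

Definition shift_composition (K : Type) (f : T -> K) : T -> K :=
  f \o backward_shift.

End Tree.

(* A [functionalBanachType P] is the set of functions satisfying [P], with
   pointwise vector operations (both from [SubLmodule]) and a complete norm;
   functions that agree everywhere are equal by extensionality and [val_inj]. *)
HB.mixin Record isFunctionalBanach (K : numFieldType) (Omega : Type)
    (P : pred (Omega -> K)) X
    of @GRing.SubLmodule K (Omega -> K) P X & CompleteNormedModule K X := {
  eval_separates : forall x y : Omega,
    (forall f : X, \val f x = \val f y) -> x = y;
  eval_continuous : forall x : Omega, continuous (fun f : X => \val f x)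
}.

#[short(type="functionalBanachType")]
HB.structure Definition FunctionalBanach (K : numFieldType) (Omega : Type)
    (P : pred (Omega -> K)) :=
  {X of @GRing.SubLmodule K (Omega -> K) P X & CompleteNormedModule K X
     & isFunctionalBanach K Omega P X}.

Definition bounded_operator (K : numFieldType) (X : normedModType K)
    (A : X -> X) : Prop :=
  linear A /\ exists M : K, forall f, `|A f| <= M * `|f|.

Definition spectrum (K : numFieldType) (X : normedModType K) (A : X -> X) :
    set K :=
  [set lambda | ~ exists B : X -> X,
    [/\ bounded_operator B, cancel (fun f => A f - lambda *: f) B
      & cancel B (fun f => A f - lambda *: f)]].

Section OperatorOn.
Variables (K : numFieldType) (Omega : Type) (P : pred (Omega -> K)).
Variable X : functionalBanachType P.
Implicit Type Phi : (Omega -> K) -> (Omega -> K).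

(* [operator_on X Phi] is meaningful only when [Phi] maps [X] into [X], a
   condition that is part of [bounded_on]; [insubd] makes it total. *)
Definition operator_on Phi (f : X) : X := insubd (0 : X) (Phi (\val f)).

Definition bounded_on Phi : Prop :=
  (forall f : X, P (Phi (\val f))) /\ bounded_operator (operator_on Phi).

Lemma val_operator_on Phi (f : X) :
  P (Phi (\val f)) -> \val (operator_on Phi f) = Phi (\val f).
Proof. by move=> PhiP; rewrite /operator_on val_insubd PhiP. Qed.

End OperatorOn.
Arguments operator_on {K Omega P} X Phi f.

Notation discreteFunctionSpace R T P :=
  (@functionalBanachType R[i] (tree_vertex T) P).

(* This makes the spectrum of [shift_composition] meaningful as soon as
   [differentiation] is bounded. *)
Lemma bounded_on_differentiation (R : realType) (T : rootedTree)
    (P : pred (T -> R[i])) (X : discreteFunctionSpace R T P) :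
  bounded_on X (@differentiation T R[i]) <->
  bounded_on X (@shift_composition T R[i]).
Proof.
have aux (Phi Psi : (T -> R[i]) -> (T -> R[i])) :
    (forall g, Psi g = g - Phi g) -> bounded_on X Phi -> bounded_on X Psi.
  move=> E [PhiX [PhiL [M PhiM]]].
  have V (f : X) : Psi (\val f) = \val (f - operator_on X Phi f).
    by rewrite E raddfB /= val_operator_on.
  have PsiX (f : X) : P (Psi (\val f)) by rewrite V; exact: valP.
  have W (f : X) : operator_on X Psi f = f - operator_on X Phi f.
    by apply: val_inj; rewrite val_operator_on.
  split=> //; split.
    by move=> a f g; rewrite !W PhiL scalerBr opprD addrACA.
  exists (1 + M) => f; rewrite W (le_trans (ler_normB _ _))//.
  by rewrite mulrDl mul1r lerD2l.
split; apply: aux => g; apply/funext => v.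
  by rewrite [RHS](_ : _ = g v - (g v - g (backward_shift v)))// opprB addrC subrK.
by [].
Qed.

(* Main.v *)
Require Import Defs.
From mathcomp Require Import all_boot all_order all_algebra.
From mathcomp Require Import complex.
From mathcomp Require Import all_classical all_reals all_analysis.

Import GRing.Theory Num.Theory.

Local Open Scope classical_set_scope.
Local Open Scope ring_scope.
Local Open Scope complex_scope.

(** By its definition the derivative is [D = I - C_b], so the result is the
    spectral mapping theorem for the polynomial [1 - z], of degree one:
    [D - lambda = - (C_b - (1 - lambda))], and an operator has a bounded inverse
    exactly when its opposite does.  The substitution [z -> 1 - z] is an
    involution, on scalars as on operators, so one inclusion
    ([spectrum_id_subr_subset]) gives both.  Boundedness of [D] ensures that both
    [D] and [C_b] map the space into itself, where [D f = f - C_b f] can then be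
    read off pointwise. *)

(** Precomposing with [-id] turns a bounded inverse of [B - (1 - lambda)] into
    one of [A - lambda]. *)
Lemma spectrum_id_subr_subset (K : numFieldType) (X : normedModType K)
    (A B : X -> X) (lambda : K) :
  (forall f, A f = f - B f) ->
  spectrum A lambda -> spectrum B (1 - lambda).
Proof.
move=> AE specA [S [[Slin [M SM]] SK KS]]; apply: specA.
have resolvent f : A f - lambda *: f = - (B f - (1 - lambda) *: f).
  by rewrite AE opprB scalerBl scale1r addrAC.
exists (S \o -%R); split.
- split; first by move=> a f g /=; rewrite opprD -scalerN Slin.
  by exists M => f /=; rewrite -[`|f|]normrN.
- by move=> f /=; rewrite resolvent opprK SK.
- by move=> f /=; rewrite resolvent KS opprK.
Qed.

Lemma spectrum_id_subr (K : numFieldType) (X : normedModType K)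
    (A B : X -> X) :
  (forall f, A f = f - B f) ->
  spectrum A = [set 1 - lambda | lambda in spectrum B].
Proof.
move=> AE.
have BE f : B f = f - A f by rewrite AE subKr.
apply/seteqP; split=> [lambda specA | _ [mu specB <-]].
  by exists (1 - lambda); [exact: spectrum_id_subr_subset AE specA | rewrite subKr].
exact: spectrum_id_subr_subset BE specB.
Qed.

Theorem theorem2p14 (R : realType) (T : rootedTree) (P : pred (T -> R[i]))
    (X : discreteFunctionSpace R T P) :
  bounded_on X (@differentiation T R[i]) ->
  spectrum (operator_on X (@differentiation T R[i])) =
  [set 1 - lambda | lambda in
     spectrum (operator_on X (@shift_composition T R[i]))].
Proof.
move=> bD; have [PC _] := (bounded_on_differentiation X).1 bD.
case: bD => PD _; apply: spectrum_id_subr => f.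
by apply: val_inj; rewrite raddfB /= !val_operator_on.
Qed.
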